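(* Let $a_0>b_0>0$ and $0<\theta_0<\frac{\pi}{2}$. Let $(a,b,\theta):\mathbb{R}\to\mathbb{R}^3$ be the solution, defined for all times, of $$a'(t)=\frac{2}{a_0+b_0}\,a(t)b(t)\cos(2\theta(t)),\qquad b'(t)=-\frac{2}{a_0+b_0}\,a(t)b(t)\cos(2\theta(t)),$$ $$\theta'(t)=-\frac{2}{a_0+b_0}\,\frac{a(t)b(t)}{a(t)-b(t)}\,\sin(2\theta(t)),$$ with $a(0)=a_0$, $b(0)=b_0$, $\theta(0)=\theta_0$. Then $\theta(t)$ is decreasing for $t\ge 0$, the limit $\theta_\infty=\lim_{t\to\infty}\theta(t)$ is positive and satisfies $\theta_\infty<\frac{\pi}{4}$ and $$\sin(2\theta_\infty)=\frac{a_0-b_0}{a_0+b_0}\,\sin(2\theta_0),$$ $b(t)\to0$ and $a(t)$ tends to a positive number as $t\to\infty$. Moreover: (i) if $0<\theta_0\le\frac{\pi}{4}$, then $a(t)$ increases and $b(t)$ decreases for $t\ge 0$; (ii) if $\frac{\pi}{4}<\theta_0<\frac{\pi}{2}$, then there is a critical time $t_0>0$ such that $a(t)$ decreases and $b(t)$ increases on $[0,t_0]$, $\theta(t_0)=\frac{\pi}{4}$, and $a(t)$ increases and $b(t)$ decreases for $t\ge t_0$. In particular, the ellipses $E(a(t),b(t),\theta(t))$ collapse as $t\to\infty$ to a segment on a line forming the positive angle $\theta_\infty$ with the horizontal axis.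
   Context: For $a,b>0$ and an angle $\theta$, $E(a,b,\theta)=e^{i\theta}\big\{(x,y)\in\mathbb{R}^2:\frac{x^2}{a^2}+\frac{y^2}{b^2}<1\big\}$ is the domain enclosed by the ellipse with semi-axes $a,b$ rotated by the angle $\theta$ (with $\mathbb{C}$ identified with $\mathbb{R}^2$). For $a_0\ne b_0$ positive and $0<\theta_0<\pi/2$ the system above has a unique solution defined for all $t\in\mathbb{R}$, staying in $\{a>0,\ b>0,\ a\ne b,\ 0<\theta<\pi/2\}$; the domains $E(a(t),b(t),\theta(t))$ are the vortex patches at time $t$ of the planar transport equation $\partial_t\rho+v\cdot\nabla\rho=0$, $v=\frac1{\pi z}\star\rho$, with initial datum the characteristic function of $E(a_0,b_0,\theta_0)$. *)

(* Defs.v *)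
From Stdlib Require Import Reals.
From Coquelicot Require Import Coquelicot.
Open Scope R_scope.

Definition cis (theta : R) : C := (cos theta, sin theta).

Definition ellipse_domain (a b theta : R) (z : C) : Prop :=
  exists x y : R,
    x ^ 2 / a ^ 2 + y ^ 2 / b ^ 2 < 1 /\ z = Cmult (cis theta) (x, y).

(* The phase space of the system is {a <> b}: [sol_dom] excludes the locus where
   the quotient in the third equation is meaningless (Rocq's division is total).
   That the solution stays in a, b > 0 and 0 < theta < PI / 2 is a consequence. *)
Record is_solution (a0 b0 theta0 : R) (a b theta : R -> R) : Prop := {
  sol_dom : forall t : R, a t <> b t;
  sol_a : forall t : R,
    is_derive a t (2 / (a0 + b0) * (a t * b t) * cos (2 * theta t));
  sol_b : forall t : R,
    is_derive b t (- (2 / (a0 + b0)) * (a t * b t) * cos (2 * theta t));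
  sol_theta : forall t : R,
    is_derive theta t
      (- (2 / (a0 + b0)) * (a t * b t / (a t - b t)) * sin (2 * theta t));
  sol_a0 : a 0 = a0;
  sol_b0 : b 0 = b0;
  sol_theta0 : theta 0 = theta0
}.

Definition increasing_on (D : R -> Prop) (f : R -> R) : Prop :=
  forall s t : R, D s -> D t -> s < t -> f s < f t.

Definition decreasing_on (D : R -> Prop) (f : R -> R) : Prop :=
  forall s t : R, D s -> D t -> s < t -> f t < f s.

Definition centered_segment (l theta : R) (z : C) : Prop :=
  exists s : R, - l <= s <= l /\ z = Cmult (RtoC s) (cis theta).

Definition thickening (eps : R) (A : C -> Prop) (z : C) : Prop :=
  exists w : C, A w /\ Cmod (Cminus z w) < eps.

(* Convergence as t -> +oo for the Hausdorff distance. *)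
Definition collapses_to (A : R -> C -> Prop) (K : C -> Prop) : Prop :=
  forall eps : R, 0 < eps ->
    Rbar_locally p_infty (fun t : R =>
      (forall z : C, A t z -> thickening eps K z) /\
      (forall z : C, K z -> thickening eps (A t) z)).

(* Main.v *)
Require Import Defs.
From Stdlib Require Import Reals.
From Coquelicot Require Import Coquelicot.
From Stdlib Require Import Lra.
Open Scope R_scope.


(** The system is integrable. The sum S = a + b is conserved, and so is
    c = (a - b) sin (2 theta) ([solution_gap_sin]): in polar coordinates with
    radius a - b and angle 2 theta, the motion stays on a horizontal line. The
    remaining coordinate u = (a - b) cos (2 theta) satisfies u' = 4 a b / S
    ([solution_gap_cos_derive]). Since 4 a b = S^2 - (a - b)^2 and
    (a - b)^2 = u^2 + c^2, this is the scalar Riccati equation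
    S u' = M^2 - u^2 with M^2 = S^2 - c^2, and b > 0 means |u| < M.

    A Riccati solution confined to (- M, M) increases strictly to M
    ([riccati_increasing], [riccati_limit]). All the other quantities are
    functions of u ([solution_riccati_form]):
      a = (S + sqrt (u^2 + c^2)) / 2,   b = (S - sqrt (u^2 + c^2)) / 2,
      theta = PI / 4 - atan (u / c) / 2.
    Hence theta decreases, while a decreases and b increases as long as u < 0,
    and conversely once u > 0. The sign of u is that of PI / 4 - theta, so the
    two cases are u 0 >= 0 and u 0 < 0, and the critical time is the zero of u.
    In the limit sqrt (u^2 + c^2) tends to S, so a tends to S, b to 0, and
    sin (2 theta) to c / S.

    The collapse of the ellipses needs only these limits: the Hausdorff
    distance between an ellipse and a centered segment is bounded explicitly in
    terms of the semi-axes, the half-length and the two angles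
    ([ellipse_near_segment], [segment_near_ellipse]). *)

(** * Functions on the line *)

Lemma derive_zero_constant (f : R -> R) :
  (forall t, is_derive f t 0) -> forall s t, f s = f t.
Proof.
  intros Hf s t.
  destruct (Rtotal_order s t) as [Hst | [-> | Hst]].
  - apply eq_is_derive; auto.
  - reflexivity.
  - symmetry; apply eq_is_derive; auto.
Qed.

(** With G a primitive of g, the product f exp (- G) is constant. *)
Lemma linear_ode_positive (f g : R -> R) :
  (forall t, is_derive f t (g t * f t)) ->
  (forall t, continuous g t) ->
  0 < f 0 -> forall t, 0 < f t.
Proof.
  intros Hf Hg Hf0 t.
  set (G := fun s => RInt g 0 s).
  assert (HG : forall s, is_derive G s (g s)).
  { intros s. apply is_derive_RInt with (a := 0).
    - apply filter_forall. intros s'. apply (RInt_correct g).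
      apply (ex_RInt_continuous g). intros; apply Hg.
    - apply Hg. }
  assert (Hconst : f t * exp (- G t) = f 0 * exp (- G 0)).
  { apply (derive_zero_constant (fun s => f s * exp (- G s))). intros s.
    auto_derive.
    - repeat split; eexists; [apply Hf | apply HG].
    - rewrite (is_derive_unique (fun x : R => f x) _ _ (Hf s)), (is_derive_unique (fun x : R => G x) _ _ (HG s)).
      ring. }
  assert (Hpos : 0 < f t * exp (- G t)).
  { rewrite Hconst. apply Rmult_lt_0_compat; [exact Hf0 | apply exp_pos]. }
  pose proof (exp_pos (- G t)). nra.
Qed.

Lemma derivable_continuity (f df : R -> R) :
  (forall t, is_derive f t (df t)) -> continuity f.
Proof.
  intros Hf t. apply continuity_pt_filterlim.
  apply (ex_derive_continuous f t). eexists; apply Hf.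
Qed.

(** The open conditions on the solution propagate from time 0 by this lemma: a
    continuous quantity that cannot vanish keeps its sign. *)
Lemma continuous_nonzero_positive (f : R -> R) :
  continuity f -> (forall t, f t <> 0) -> 0 < f 0 -> forall t, 0 < f t.
Proof.
  intros Hc Hnz H0 t.
  destruct (Rlt_or_le 0 (f t)) as [Hpos | Hneg]; [exact Hpos | exfalso].
  destruct (IVT_gen f 0 t 0 Hc) as [x [_ Hx]].
  - rewrite Rmin_right, Rmax_left; lra.
  - exact (Hnz x Hx).
Qed.

Lemma riccati_increasing (u : R -> R) (M S : R) :
  0 < S ->
  (forall t, is_derive u t ((M ^ 2 - u t ^ 2) / S)) ->
  (forall t, - M < u t < M) ->
  forall s t, s < t -> u s < u t.
Proof.
  intros HS Hu Hb s t Hst.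
  apply (incr_function u m_infty p_infty (fun x => (M ^ 2 - u x ^ 2) / S));
    simpl; auto.
  intros x _ _. apply Rlt_gt, Rdiv_lt_0_compat; [| exact HS].
  specialize (Hb x). nra.
Qed.

(** The Riccati equation linearizes in w = (M + u) / (M - u), for which
    w' = (2 M / S) w. Hence M - u = (M + u) exp (- 2 M t / S) / w 0, which
    decays exponentially because M + u < 2 M. *)
Lemma riccati_limit (u : R -> R) (M S : R) :
  0 < S ->
  (forall t, is_derive u t ((M ^ 2 - u t ^ 2) / S)) ->
  (forall t, - M < u t < M) ->
  is_lim u p_infty M.
Proof.
  intros HS Hu Hb.
  assert (HM : 0 < M) by (specialize (Hb 0); lra).
  set (k := 2 * M / S).
  assert (Hk : 0 < k) by (apply Rdiv_lt_0_compat; lra).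
  set (w := (M + u 0) / (M - u 0)).
  assert (Hw : 0 < w) by (specialize (Hb 0); apply Rdiv_lt_0_compat; lra).
  assert (Hconst : forall t, (M + u t) / (M - u t) * exp (- (k * t)) = w).
  { intros t.
    transitivity ((M + u 0) / (M - u 0) * exp (- (k * 0))).
    - apply (derive_zero_constant
               (fun s => (M + u s) / (M - u s) * exp (- (k * s)))).
      intros s. specialize (Hb s). auto_derive.
      + repeat split; try lra; eexists; apply Hu.
      + rewrite (is_derive_unique (fun x : R => u x) _ _ (Hu s)). unfold k. field. lra.
    - unfold w. replace (- (k * 0)) with 0 by ring. rewrite exp_0. ring. }
  assert (Hexp : is_lim (fun t => exp (- (k * t))) p_infty 0).
  { apply (is_lim_comp exp (fun t => - (k * t)) p_infty 0 m_infty).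
    - apply is_lim_exp_m.
    - replace m_infty with (Rbar_opp (Rbar_mult k p_infty)).
      + apply is_lim_opp. apply is_lim_scal_l. apply is_lim_id.
      + simpl. destruct (Rle_dec 0 k) as [h | h]; [| exfalso; lra].
        destruct (Rle_lt_or_eq_dec 0 k h); [reflexivity | exfalso; lra].
    - exists 0. discriminate. }
  apply (is_lim_le_le_loc (fun t => M - 2 * M / w * exp (- (k * t)))
           (fun _ => M)).
  - exists 0. intros t _. specialize (Hb t). split; [| lra].
    assert (He : M - u t = (M + u t) / w * exp (- (k * t))).
    { rewrite <- (Hconst t). pose proof (exp_pos (- (k * t))). field. lra. }
    pose proof (exp_pos (- (k * t))).
    assert ((M + u t) / w <= 2 * M / w).
    { apply Rmult_le_compat_r; [| lra].
      apply Rlt_le, Rinv_0_lt_compat, Hw. }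
    nra.
  - replace (Finite M) with (Finite (M - 2 * M / w * 0)) by (f_equal; ring).
    apply is_lim_minus'; [apply is_lim_const |].
    apply (is_lim_scal_l _ (2 * M / w) p_infty 0 Hexp).
  - apply is_lim_const.
Qed.

(** * Invariants of the system *)

Lemma solution_sum a0 b0 theta0 a b theta :
  is_solution a0 b0 theta0 a b theta -> forall t, a t + b t = a0 + b0.
Proof.
  intros [_ Ha Hb _ Ha0 Hb0 _] t. rewrite <- Ha0, <- Hb0.
  apply (derive_zero_constant (fun s => a s + b s)). intros s.
  auto_derive.
  - repeat split; eexists; [apply Ha | apply Hb].
  - rewrite (is_derive_unique (fun x : R => a x) _ _ (Ha s)), (is_derive_unique (fun x : R => b x) _ _ (Hb s)).
    ring.
Qed.

(** The phase space excludes a = b, so a - b keeps its initial sign. *)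
Lemma solution_gap_pos a0 b0 theta0 a b theta :
  is_solution a0 b0 theta0 a b theta -> b0 < a0 -> forall t, 0 < a t - b t.
Proof.
  intros [Hd Ha Hb _ Ha0 Hb0 _] H0.
  apply (continuous_nonzero_positive (fun t => a t - b t)).
  - exact (continuity_minus a b (derivable_continuity a _ Ha)
             (derivable_continuity b _ Hb)).
  - intros t. specialize (Hd t). lra.
  - rewrite Ha0, Hb0. lra.
Qed.

Lemma solution_gap_sin a0 b0 theta0 a b theta :
  is_solution a0 b0 theta0 a b theta ->
  forall t, (a t - b t) * sin (2 * theta t) = (a0 - b0) * sin (2 * theta0).
Proof.
  intros [Hd Ha Hb Ht Ha0 Hb0 Ht0] t. rewrite <- Ha0, <- Hb0, <- Ht0.
  apply (derive_zero_constant (fun s => (a s - b s) * sin (2 * theta s))).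
  intros s. auto_derive.
  - repeat split; eexists; [apply Ha | apply Hb | apply Ht].
  - rewrite (is_derive_unique (fun x : R => a x) _ _ (Ha s)), (is_derive_unique (fun x : R => b x) _ _ (Hb s)),
      (is_derive_unique (fun x : R => theta x) _ _ (Ht s)).
    specialize (Hd s). generalize (2 / (a0 + b0)); intros k. field. lra.
Qed.

(** At theta = 0 or theta = PI / 2 the conserved quantity
    (a - b) sin (2 theta) would be zero, but it is positive initially. *)
Lemma solution_angle_range a0 b0 theta0 a b theta :
  is_solution a0 b0 theta0 a b theta -> b0 < a0 -> 0 < theta0 < PI / 2 ->
  forall t, 0 < theta t < PI / 2.
Proof.
  intros Hsol H0 Hth0 t.
  pose proof (solution_gap_sin _ _ _ _ _ _ Hsol) as Hc.
  assert (Hs0 : 0 < (a0 - b0) * sin (2 * theta0)).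
  { apply Rmult_lt_0_compat; [lra | apply sin_gt_0; lra]. }
  assert (Hcont : continuity theta)
    by exact (derivable_continuity theta _ (sol_theta _ _ _ _ _ _ Hsol)).
  pose proof (sol_theta0 _ _ _ _ _ _ Hsol) as Ht0.
  split.
  - revert t. apply continuous_nonzero_positive; [exact Hcont | | lra].
    intros t Ht. specialize (Hc t). rewrite Ht, Rmult_0_r, sin_0 in Hc. lra.
  - enough (0 < PI / 2 - theta t) by lra. revert t.
    apply (continuous_nonzero_positive (fun t => PI / 2 - theta t)).
    + apply (continuity_minus (fun _ => PI / 2)); [| exact Hcont].
      apply continuity_const. intros x y; reflexivity.
    + intros t Ht. specialize (Hc t).
      replace (2 * theta t) with PI in Hc by lra. rewrite sin_PI in Hc. lra.
    + lra.
Qed.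

(** The equation for b is linear in b with a continuous coefficient. *)
Lemma solution_minor_axis_pos a0 b0 theta0 a b theta :
  is_solution a0 b0 theta0 a b theta -> 0 < b0 -> forall t, 0 < b t.
Proof.
  intros [Hd Ha Hb Ht Ha0 Hb0 Ht0] H0.
  apply (linear_ode_positive b
           (fun t => - (2 / (a0 + b0)) * a t * cos (2 * theta t))).
  - intros t. evar_last; [apply Hb |]. ring.
  - intros t.
    apply (ex_derive_continuous
             (fun t => - (2 / (a0 + b0)) * a t * cos (2 * theta t))).
    auto_derive. repeat split; eexists; [apply Ha | apply Ht].
  - lra.
Qed.

Lemma solution_gap_cos_derive a0 b0 theta0 a b theta :
  is_solution a0 b0 theta0 a b theta -> a0 + b0 <> 0 ->
  forall t, is_derive (fun s => (a s - b s) * cos (2 * theta s)) t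
    (4 * (a t * b t) / (a0 + b0)).
Proof.
  intros [Hd Ha Hb Ht _ _ _] HS t. auto_derive.
  - repeat split; eexists; [apply Ha | apply Hb | apply Ht].
  - rewrite (is_derive_unique (fun x : R => a x) _ _ (Ha t)), (is_derive_unique (fun x : R => b x) _ _ (Hb t)),
      (is_derive_unique (fun x : R => theta x) _ _ (Ht t)).
    specialize (Hd t).
    transitivity (4 * (a t * b t) / (a0 + b0)
      * ((sin (2 * theta t))² + (cos (2 * theta t))²)).
    + unfold Rsqr. field. lra.
    + rewrite sin2_cos2. ring.
Qed.

(** The arctangent determines an angle in an interval of length PI centered at 0,
    so it is applied to PI / 2 - 2 theta, whose tangent is the cotangent of
    2 theta. *)
Lemma double_angle_atan (d theta : R) :
  0 < d -> 0 < theta < PI / 2 ->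
  theta = PI / 4 - atan (d * cos (2 * theta) / (d * sin (2 * theta))) / 2.
Proof.
  intros Hd Hth.
  assert (0 < sin (2 * theta)) by (apply sin_gt_0; lra).
  replace (d * cos (2 * theta) / (d * sin (2 * theta)))
    with (tan (PI / 2 - 2 * theta)).
  - rewrite atan_tan; lra.
  - unfold tan. rewrite sin_shift, cos_shift. field. lra.
Qed.

(** * Convergence of ellipses to a segment *)

Definition cis_gap (alpha beta : R) : R :=
  Rabs (cos alpha - cos beta) + Rabs (sin alpha - sin beta).

Lemma Cmod_pair_le (x y : R) : Cmod (x, y) <= Rabs x + Rabs y.
Proof.
  unfold Cmod; simpl.
  pose proof (Rabs_pos x). pose proof (Rabs_pos y).
  rewrite <- (sqrt_Rsqr (Rabs x + Rabs y)) by lra.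
  apply sqrt_le_1_alt. unfold Rsqr.
  pose proof (Rsqr_abs x). pose proof (Rsqr_abs y). unfold Rsqr in *. nra.
Qed.

Lemma Cmod_cis (theta : R) : Cmod (cis theta) = 1.
Proof.
  unfold Cmod, cis; simpl. transitivity (sqrt 1); [f_equal | apply sqrt_1].
  pose proof (sin2_cos2 theta). unfold Rsqr in *. lra.
Qed.

(** Splits the displacement into the rotation of the point x of the major axis,
    the translation from x to s along the segment, and the offset y along the
    minor axis. *)
Lemma point_segment_distance (x y s alpha beta : R) :
  Cmod (Cminus (Cmult (cis alpha) (x, y)) (Cmult (RtoC s) (cis beta))) <=
  Rabs x * cis_gap alpha beta + Rabs (x - s) + Rabs y.
Proof.
  replace (Cminus (Cmult (cis alpha) (x, y)) (Cmult (RtoC s) (cis beta)))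
    with (Cplus (Cplus (Cmult (RtoC x) (Cminus (cis alpha) (cis beta)))
                  (Cmult (RtoC (x - s)) (cis beta)))
            (Cmult (cis alpha) (0, y))).
  2: { unfold cis, Cminus, Cplus, Cmult, Copp, RtoC; simpl.
       f_equal; ring. }
  eapply Rle_trans; [apply Cmod_triangle |].
  apply Rplus_le_compat.
  - eapply Rle_trans; [apply Cmod_triangle |].
    apply Rplus_le_compat; rewrite Cmod_mult, Cmod_R.
    + apply Rmult_le_compat_l; [apply Rabs_pos |].
      apply (Cmod_pair_le (cos alpha - cos beta) (sin alpha - sin beta)).
    + rewrite Cmod_cis. lra.
  - rewrite Cmod_mult, Cmod_cis.
    pose proof (Cmod_pair_le 0 y). rewrite Rabs_R0 in H. lra.
Qed.

Lemma ellipse_bounds (a b x y : R) :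
  0 < a -> 0 < b -> x ^ 2 / a ^ 2 + y ^ 2 / b ^ 2 < 1 ->
  Rabs x <= a /\ Rabs y <= b.
Proof.
  intros Ha Hb H.
  assert (Haux : forall c z, 0 < c -> z ^ 2 / c ^ 2 <= 1 -> Rabs z <= c).
  { intros c z Hc Hz. rewrite <- (Rabs_pos_eq c) by lra.
    apply Rsqr_le_abs_0. unfold Rsqr.
    apply (Rmult_le_compat_r (c ^ 2)) in Hz; [| nra].
    replace (z ^ 2 / c ^ 2 * c ^ 2) with (z ^ 2) in Hz by (field; lra). nra. }
  assert (Hq : forall c z, 0 < c -> 0 <= z ^ 2 / c ^ 2).
  { intros c z Hc. apply Rmult_le_pos; [nra |].
    apply Rlt_le, Rinv_0_lt_compat. nra. }
  pose proof (Hq a x Ha). pose proof (Hq b y Hb).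
  split; apply Haux; lra.
Qed.

(** The nearby point of the segment is the projection to the major axis, rescaled
    from half-length a to half-length l and rotated. *)
Lemma ellipse_near_segment (a b l alpha beta : R) (z : C) :
  0 < a -> 0 < b -> 0 < l -> ellipse_domain a b alpha z ->
  exists w, centered_segment l beta w /\
    Cmod (Cminus z w) <= a * cis_gap alpha beta + Rabs (a - l) + b.
Proof.
  intros Ha Hb Hl [x [y [Hxy ->]]].
  destruct (ellipse_bounds a b x y Ha Hb Hxy) as [Hx Hy].
  set (q := x / a).
  assert (Hxq : x = q * a) by (unfold q; field; lra).
  assert (Hq : Rabs q <= 1).
  { rewrite Hxq, Rabs_mult, (Rabs_pos_eq a) in Hx by lra. nra. }
  exists (Cmult (RtoC (q * l)) (cis beta)). split.
  - exists (q * l). split; [| reflexivity].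
    apply Rabs_le_between in Hq. nra.
  - eapply Rle_trans; [apply point_segment_distance |].
    assert (Hg : 0 <= cis_gap alpha beta)
      by (apply Rplus_le_le_0_compat; apply Rabs_pos).
    assert (Rabs (x - q * l) <= Rabs (a - l)).
    { replace (x - q * l) with (q * (a - l)) by (rewrite Hxq; ring).
      rewrite Rabs_mult. pose proof (Rabs_pos (a - l)). nra. }
    nra.
Qed.

(** The point of the segment is rescaled to the major axis and rotated. As the
    ellipse is open, the rescaling shrinks by a further factor a / (a + b), which
    moves points by at most b. *)
Lemma segment_near_ellipse (a b l alpha beta : R) (z : C) :
  0 < a -> 0 < b -> 0 < l -> centered_segment l beta z ->
  exists w, ellipse_domain a b alpha w /\
    Cmod (Cminus z w) <= a * cis_gap alpha beta + Rabs (a - l) + b.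
Proof.
  intros Ha Hb Hl [s [Hs ->]].
  set (q := s / l).
  assert (Hsq : s = q * l) by (unfold q; field; lra).
  assert (Hq : Rabs q <= 1).
  { apply Rabs_le_between. rewrite Hsq in Hs. split; nra. }
  (* the factor a / (a + b) < 1 brings the endpoints strictly inside *)
  set (r := a / (a + b)).
  assert (Hr : 0 < r < 1).
  { unfold r. split; [apply Rdiv_lt_0_compat; lra |].
    apply Rlt_div_l; lra. }
  assert (Har : a * (1 - r) <= b).
  { replace (a * (1 - r)) with (r * b) by (unfold r; field; lra). nra. }
  exists (Cmult (cis alpha) (q * r * a, 0)). split.
  - exists (q * r * a), 0. split; [| reflexivity].
    replace ((q * r * a) ^ 2 / a ^ 2 + 0 ^ 2 / b ^ 2) with (q ^ 2 * r ^ 2)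
      by (field; lra).
    apply Rabs_le_between in Hq.
    assert (q ^ 2 <= 1) by nra. assert (r ^ 2 < 1) by nra. nra.
  - rewrite <- Cmod_opp.
    replace (Copp (Cminus (Cmult (RtoC s) (cis beta))
                     (Cmult (cis alpha) (q * r * a, 0))))
      with (Cminus (Cmult (cis alpha) (q * r * a, 0))
              (Cmult (RtoC s) (cis beta))) by ring.
    eapply Rle_trans; [apply point_segment_distance |].
    assert (Hg : 0 <= cis_gap alpha beta)
      by (apply Rplus_le_le_0_compat; apply Rabs_pos).
    assert (Hx : Rabs (q * r * a) <= a).
    { rewrite !Rabs_mult, (Rabs_pos_eq a), (Rabs_pos_eq r) by lra.
      pose proof (Rabs_pos q). assert (Rabs q * r <= 1) by nra. nra. }
    assert (Hxs : Rabs (q * r * a - s) <= Rabs (a - l) + b).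
    { replace (q * r * a - s) with (q * ((a - l) - a * (1 - r)))
        by (rewrite Hsq; ring).
      rewrite Rabs_mult.
      assert (Rabs (a - l - a * (1 - r)) <= Rabs (a - l) + b).
      { eapply Rle_trans; [apply Rabs_triang |].
        rewrite Rabs_Ropp, (Rabs_pos_eq (a * (1 - r))) by nra. lra. }
      pose proof (Rabs_pos (a - l - a * (1 - r))). pose proof (Rabs_pos q).
      nra. }
    rewrite Rabs_R0. nra.
Qed.

Lemma ellipses_collapse (a b theta : R -> R) (l phi : R) :
  (forall t, 0 < a t) -> (forall t, 0 < b t) -> 0 < l ->
  is_lim a p_infty l -> is_lim b p_infty 0 -> is_lim theta p_infty phi ->
  collapses_to (fun t => ellipse_domain (a t) (b t) (theta t))
    (centered_segment l phi).
Proof.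
  intros Ha Hb Hl Hla Hlb Hlt eps Heps.
  set (err := fun t => a t * cis_gap (theta t) phi + Rabs (a t - l) + b t).
  assert (Herr : is_lim err p_infty 0).
  { assert (Htrig : forall f : R -> R, continuous f phi ->
      is_lim (fun t => Rabs (f (theta t) - f phi)) p_infty 0).
    { intros f Hf. rewrite <- Rabs_R0, <- (Rminus_diag (f phi)).
      apply (is_lim_Rabs (fun t => f (theta t) - f phi)
               p_infty (Finite (f phi - f phi))).
      apply is_lim_minus'; [| apply is_lim_const].
      apply is_lim_comp_continuous; assumption. }
    replace (Finite 0) with (Finite (l * (0 + 0) + Rabs (l - l) + 0))
      by (f_equal; rewrite Rminus_diag, Rabs_R0; ring).
    apply is_lim_plus'; [| exact Hlb].
    apply is_lim_plus'.
    - apply (is_lim_mult a (fun t => cis_gap (theta t) phi) p_infty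
               (Finite l) (Finite (0 + 0))); [exact Hla | | exact I].
      apply is_lim_plus'; apply Htrig;
        [apply continuous_cos | apply continuous_sin].
    - apply (is_lim_Rabs (fun t => a t - l) p_infty (Finite (l - l))).
      apply is_lim_minus'; [exact Hla | apply is_lim_const]. }
  apply is_lim_spec in Herr. specialize (Herr (mkposreal eps Heps)).
  revert Herr. apply filter_imp. intros t Ht. simpl in Ht.
  rewrite Rminus_0_r in Ht. pose proof (Rle_abs (err t)).
  split; intros z Hz.
  - destruct (ellipse_near_segment (a t) (b t) l (theta t) phi z)
      as [w [Hw Hd]]; auto.
    exists w. split; [exact Hw |]. fold (err t) in Hd. lra.
  - destruct (segment_near_ellipse (a t) (b t) l (theta t) phi z)
      as [w [Hw Hd]]; auto.
    exists w. split; [exact Hw |]. fold (err t) in Hd. lra.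
Qed.

(** * Reduction to one Riccati equation *)

(** Everything about the solution is read off from one scalar function u, the
    coordinate (a - b) cos (2 theta) of the point with polar coordinates
    (a - b, 2 theta); its other coordinate is the constant c. *)
Lemma solution_riccati_form a0 b0 theta0 a b theta :
  b0 < a0 -> 0 < b0 -> 0 < theta0 < PI / 2 ->
  is_solution a0 b0 theta0 a b theta ->
  let S := a0 + b0 in
  let c := (a0 - b0) * sin (2 * theta0) in
  exists (u : R -> R) (M : R),
    0 < c /\ 0 < M /\ M ^ 2 = S ^ 2 - c ^ 2 /\
    u 0 = (a0 - b0) * cos (2 * theta0) /\
    (forall t, is_derive u t ((M ^ 2 - u t ^ 2) / S)) /\
    (forall t, - M < u t < M) /\
    (forall t, 0 < b t) /\
    (forall t, a t = (S + sqrt (u t ^ 2 + c ^ 2)) / 2) /\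
    (forall t, b t = (S - sqrt (u t ^ 2 + c ^ 2)) / 2) /\
    (forall t, theta t = PI / 4 - atan (u t / c) / 2).
Proof.
  intros H0 Hb0 Hth0 Hsol S c.
  pose proof (solution_sum _ _ _ _ _ _ Hsol) as Hsum.
  pose proof (solution_gap_pos _ _ _ _ _ _ Hsol H0) as Hgap.
  pose proof (solution_gap_sin _ _ _ _ _ _ Hsol) as Hsin.
  pose proof (solution_angle_range _ _ _ _ _ _ Hsol H0 Hth0) as Hang.
  pose proof (solution_minor_axis_pos _ _ _ _ _ _ Hsol Hb0) as Hb.
  assert (HS : 0 < S) by (unfold S; lra).
  pose proof (solution_gap_cos_derive _ _ _ _ _ _ Hsol (Rgt_not_eq _ _ HS))
    as Hder.
  fold S in Hsum, Hder. fold c in Hsin.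
  set (u := fun s => (a s - b s) * cos (2 * theta s)) in *.
  assert (Hc : 0 < c).
  { unfold c. apply Rmult_lt_0_compat; [lra | apply sin_gt_0; lra]. }
  (* c < S makes the stationary points - M and M of the Riccati equation real
     and distinct *)
  assert (HcS : c < S).
  { unfold c, S. pose proof (SIN_bound (2 * theta0)). nra. }
  assert (Hsq : forall t, u t ^ 2 + c ^ 2 = (a t - b t) ^ 2).
  { intros t. rewrite <- (Hsin t). unfold u.
    pose proof (sin2_cos2 (2 * theta t)) as E. unfold Rsqr in E.
    transitivity ((a t - b t) ^ 2
      * (sin (2 * theta t) * sin (2 * theta t)
         + cos (2 * theta t) * cos (2 * theta t))); [ring |].
    rewrite E. ring. }
  assert (Hsqrt : forall t, sqrt (u t ^ 2 + c ^ 2) = a t - b t).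
  { intros t. rewrite Hsq. apply sqrt_pow2. specialize (Hgap t). lra. }
  set (M := sqrt (S ^ 2 - c ^ 2)).
  assert (HM : 0 < M) by (apply sqrt_lt_R0; nra).
  assert (HM2 : M ^ 2 = S ^ 2 - c ^ 2) by (apply pow2_sqrt; nra).
  assert (Hab : forall t, M ^ 2 - u t ^ 2 = 4 * (a t * b t)).
  { intros t. specialize (Hsq t). rewrite HM2, <- (Hsum t). nra. }
  exists u, M.
  assert (Hbnd : forall t, - M < u t < M).
  { intros t. specialize (Hab t). specialize (Hb t). specialize (Hgap t).
    assert (0 < a t * b t) by nra. nra. }
  assert (Hinit : u 0 = (a0 - b0) * cos (2 * theta0)).
  { unfold u. destruct Hsol as [_ _ _ _ -> -> ->]. reflexivity. }
  assert (Hode : forall t, is_derive u t ((M ^ 2 - u t ^ 2) / S)).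
  { intros t. rewrite Hab. apply Hder. }
  do 7 (split; [assumption |]). split; [| split].
  - intros t. rewrite Hsqrt. specialize (Hsum t). lra.
  - intros t. rewrite Hsqrt. specialize (Hsum t). lra.
  - intros t. rewrite <- (Hsin t). unfold u.
    apply double_angle_atan; auto.
Qed.

(** * Evolution of the axes and of the angle *)

Lemma sqrt_sum_sq_lt (c x y : R) :
  Rabs x < Rabs y -> sqrt (x ^ 2 + c ^ 2) < sqrt (y ^ 2 + c ^ 2).
Proof.
  intros H. apply Rsqr_lt_abs_1 in H. unfold Rsqr in H.
  apply sqrt_lt_1_alt. nra.
Qed.

Theorem mainTheorem4 :
  forall (a0 b0 theta0 : R) (a b theta : R -> R),
    b0 < a0 -> 0 < b0 -> 0 < theta0 < PI / 2 ->
    is_solution a0 b0 theta0 a b theta ->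
    decreasing_on (fun t => 0 <= t) theta /\
    (exists theta_inf a_inf : R,
      is_lim theta p_infty theta_inf /\
      0 < theta_inf /\
      theta_inf < PI / 4 /\
      sin (2 * theta_inf) = (a0 - b0) / (a0 + b0) * sin (2 * theta0) /\
      is_lim b p_infty 0 /\
      is_lim a p_infty a_inf /\
      0 < a_inf /\
      collapses_to (fun t => ellipse_domain (a t) (b t) (theta t))
        (centered_segment a_inf theta_inf)) /\
    (0 < theta0 <= PI / 4 ->
      increasing_on (fun t => 0 <= t) a /\
      decreasing_on (fun t => 0 <= t) b) /\
    (PI / 4 < theta0 < PI / 2 ->
      exists t0 : R,
        0 < t0 /\
        decreasing_on (fun t => 0 <= t <= t0) a /\
        increasing_on (fun t => 0 <= t <= t0) b /\
        theta t0 = PI / 4 /\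
        increasing_on (fun t => t0 <= t) a /\
        decreasing_on (fun t => t0 <= t) b).
Proof.
  intros a0 b0 theta0 a b theta H0 Hb0 Hth0 Hsol.
  destruct (solution_riccati_form _ _ _ _ _ _ H0 Hb0 Hth0 Hsol)
    as (u & M & Hc & HM & HM2 & Hu0 & Hder & Hbnd & Hb & Ha & Hb' & Hth).
  set (S := a0 + b0) in *. set (c := (a0 - b0) * sin (2 * theta0)) in *.
  assert (HS : 0 < S) by (unfold S; lra).
  pose proof (riccati_increasing u M S HS Hder Hbnd) as Hinc.
  pose proof (riccati_limit u M S HS Hder Hbnd) as Hlim.
  assert (Hgrow : forall s t, 0 <= u s -> s < t -> a s < a t /\ b t < b s).
  { intros s t Hs Hst. rewrite !Ha, !Hb'. specialize (Hinc s t Hst).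
    assert (sqrt (u s ^ 2 + c ^ 2) < sqrt (u t ^ 2 + c ^ 2)).
    { apply sqrt_sum_sq_lt. rewrite !Rabs_pos_eq; lra. }
    lra. }
  assert (Hshrink : forall s t, u t <= 0 -> s < t -> a t < a s /\ b s < b t).
  { intros s t Ht Hst. rewrite !Ha, !Hb'. specialize (Hinc s t Hst).
    assert (sqrt (u t ^ 2 + c ^ 2) < sqrt (u s ^ 2 + c ^ 2)).
    { apply sqrt_sum_sq_lt. rewrite !Rabs_left1; lra. }
    lra. }
  assert (Hlim_gap : is_lim (fun t => sqrt (u t ^ 2 + c ^ 2)) p_infty S).
  { replace S with (sqrt (M ^ 2 + c ^ 2)).
    - apply (is_lim_comp_continuous u (fun x => sqrt (x ^ 2 + c ^ 2)));
        [exact Hlim |].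
      apply (continuous_sqrt_comp (fun x => x ^ 2 + c ^ 2)).
      apply (ex_derive_continuous (fun x => x ^ 2 + c ^ 2)). auto_derive. auto.
    - rewrite HM2. replace (S ^ 2 - c ^ 2 + c ^ 2) with (S ^ 2) by ring.
      apply sqrt_pow2. lra. }
  assert (Hlim_a : is_lim a p_infty S).
  { apply is_lim_ext with (1 := fun t => eq_sym (Ha t)).
    replace (Finite S) with (Finite ((S + S) / 2)) by (f_equal; field).
    apply (is_lim_scal_r _ (/ 2) p_infty (Finite (S + S))).
    apply is_lim_plus'; [apply is_lim_const | exact Hlim_gap]. }
  assert (Hlim_b : is_lim b p_infty 0).
  { apply is_lim_ext with (1 := fun t => eq_sym (Hb' t)).
    replace (Finite 0) with (Finite ((S - S) / 2)) by (f_equal; field).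
    apply (is_lim_scal_r _ (/ 2) p_infty (Finite (S - S))).
    apply is_lim_minus'; [apply is_lim_const | exact Hlim_gap]. }
  set (phi := PI / 4 - atan (M / c) / 2).
  assert (Hlim_th : is_lim theta p_infty phi).
  { apply is_lim_ext with (1 := fun t => eq_sym (Hth t)).
    apply (is_lim_comp_continuous u (fun x => PI / 4 - atan (x / c) / 2));
      [exact Hlim |].
    apply (ex_derive_continuous (fun x => PI / 4 - atan (x / c) / 2)).
    auto_derive. auto. }
  assert (HMc : 0 < M / c) by (apply Rdiv_lt_0_compat; assumption).
  split; [| split; [| split]].
  - intros s t _ _ Hst. rewrite !Hth.
    assert (atan (u s / c) < atan (u t / c)).
    { apply atan_increasing. apply Rmult_lt_compat_r; [| auto].
      apply Rinv_0_lt_compat, Hc. }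
    lra.
  - exists phi, S. repeat split; auto.
    + unfold phi. pose proof (atan_bound (M / c)). lra.
    + unfold phi. pose proof (atan_increasing 0 (M / c) HMc).
      rewrite atan_0 in H. lra.
    + unfold phi.
      replace (2 * (PI / 4 - atan (M / c) / 2)) with (PI / 2 - atan (M / c))
        by field.
      rewrite sin_shift, cos_atan.
      replace (1 + (M / c)²) with ((S / c) ^ 2).
      2: { unfold Rsqr. apply Rmult_eq_reg_r with (c ^ 2); [| nra].
           field_simplify; try lra. }
      rewrite sqrt_pow2 by (apply Rlt_le, Rdiv_lt_0_compat; assumption).
      transitivity (c / S); [field; lra | unfold c; field; lra].
    + apply ellipses_collapse; auto.
      intros t. rewrite Ha. pose proof (sqrt_pos (u t ^ 2 + c ^ 2)). lra.
  - intros Hle.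
    assert (Hu0' : 0 <= u 0).
    { rewrite Hu0. apply Rmult_le_pos; [lra | apply cos_ge_0; lra]. }
    assert (Hpos : forall s, 0 <= s -> 0 <= u s).
    { intros s [Hs | <-]; [specialize (Hinc 0 s Hs); lra | exact Hu0']. }
    split; intros s t Hs _ Hst; apply Hgrow; auto.
  - intros Hgt.
    assert (Hu0' : u 0 < 0).
    { rewrite Hu0. assert (cos (2 * theta0) < 0) by (apply cos_lt_0; lra). nra. }
    destruct (proj2 (is_lim_spec _ _ _) Hlim (mkposreal M HM)) as [T HT].
    specialize (HT (T + 1) ltac:(lra)). simpl in HT.
    apply Rabs_lt_between in HT.
    destruct (IVT_gen u 0 (T + 1) 0) as [t0 [_ Ht0]].
    { exact (derivable_continuity u _ Hder). }
    { rewrite Rmin_left, Rmax_right; lra. }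
    assert (Hpos : 0 < t0).
    { destruct (Rtotal_order 0 t0) as [h | [<- | h]]; [exact h | lra |].
      specialize (Hinc t0 0 h). lra. }
    assert (Hbefore : forall s, s <= t0 -> u s <= 0).
    { intros s [Hs | ->]; [specialize (Hinc s t0 Hs); lra | lra]. }
    assert (Hafter : forall s, t0 <= s -> 0 <= u s).
    { intros s [Hs | <-]; [specialize (Hinc t0 s Hs); lra | lra]. }
    exists t0. split; [exact Hpos |].
    repeat split; try (intros s t Hs Ht Hst).
    + apply Hshrink; [apply Hbefore; lra | exact Hst].
    + apply Hshrink; [apply Hbefore; lra | exact Hst].
    + rewrite Hth, Ht0. unfold Rdiv at 3. rewrite Rmult_0_l, atan_0. lra.
    + apply Hgrow; [apply Hafter; lra | exact Hst].
    + apply Hgrow; [apply Hafter; lra | exact Hst].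
Qed.
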